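(* Let $\ell$ be a positive integer and let $G$ be a connected graph of order $n\ge 2$. (1) If $G$ has an $\ell$-congruent spanning tree, then $n\equiv 2\pmod{\ell}$. (2) Conversely, if $n\equiv 2\pmod{\ell}$ and $\delta(G)> \frac{(\ell-1)n}{\ell}$, then $G$ has an $\ell$-congruent spanning tree.
   Context: Graphs are finite and simple (undirected, no loops or multiple edges). The order of a graph is its number of vertices, $\delta(G)$ denotes the minimum vertex degree of $G$, and $d_T(v)$ denotes the degree of $v$ in $T$. A tree is nontrivial if it has at least two vertices. For a positive integer $\ell$, an $\ell$-congruent tree is a nontrivial tree $T$ such that the degrees of all vertices of $T$ are congruent modulo $\ell$; equivalently (since a nontrivial tree has a leaf), $d_T(v)\equiv 1\pmod{\ell}$ for every $v\in V(T)$. An $\ell$-congruent spanning tree of a graph $G$ is a spanning tree of $G$ that is an $\ell$-congruent tree. *)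

(* Defs.v *)
From mathcomp Require Import all_boot all_order all_algebra.

Set Implicit Arguments.
Unset Strict Implicit.
Unset Printing Implicit Defensive.

Record sgraph (V : finType) := SGraph {
  adj :> rel V;
  adj_sym : symmetric adj;
  adj_irrefl : irreflexive adj
}.

Section Graphs.
Variable V : finType.
Implicit Types (G T : sgraph V) (v : V).

Definition degree G v : nat := #|[set u | G v u]|.

(* Degrees are smaller than #|V|, so the default value #|V| of the iterated
   minimum only matters for the graph without vertices. *)
Definition min_degree G : nat := \big[minn/#|V|]_(v : V) degree G v.

Definition connected_graph G : Prop :=
  0 < #|V| /\ forall u v, connect G u v.

(* [ucycle G c] also holds for the empty sequence and for [:: u; v] with u, v
   adjacent; the cycles of a simple graph are those with at least 3 vertices. *)
Definition acyclic_graph G : Prop :=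
  forall c : seq V, ucycle G c -> size c < 3.

Definition is_tree T : Prop := connected_graph T /\ acyclic_graph T.

Definition congruent_tree (l : nat) T : Prop :=
  [/\ is_tree T, 1 < #|V| & forall u v, degree T u = degree T v %[mod l]].

(* T has the same vertex type as G, hence is automatically spanning. *)
Definition congruent_spanning_tree (l : nat) G T : Prop :=
  subrel T G /\ congruent_tree l T.

Lemma degree_lt_card G v : degree G v < #|V|.
Proof.
rewrite -cardsT; apply: proper_card; apply/properP; split; first exact: subsetT.
by exists v; rewrite ?inE // adj_irrefl.
Qed.

Lemma min_degree_le G v : min_degree G <= degree G v.
Proof.
rewrite /min_degree; have := mem_index_enum v.
elim: (index_enum V) => //= w s IHs; rewrite big_cons inE.
case/predU1P=> [-> | /IHs le_s]; first exact: geq_minl.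
exact: leq_trans (geq_minr _ _) le_s.
Qed.

Lemma min_degree_attained G : 0 < #|V| -> exists v, min_degree G = degree G v.
Proof.
case/card_gt0P=> v0 _.
have : min_degree G = #|V| \/ exists v, min_degree G = degree G v.
  rewrite /min_degree.
  elim/big_ind: _ => [|x y Hx Hy|v _]; [by left| |by right; exists v].
  by rewrite /minn; case: ifP.
case=> // E; have := leq_ltn_trans (min_degree_le G v0) (degree_lt_card G v0).
by rewrite E ltnn.
Qed.

End Graphs.

(* Main.v *)
Require Import Defs.
From mathcomp Require Import all_boot all_order all_algebra.
From mathcomp Require Import zify.

Set Implicit Arguments.
Unset Strict Implicit.
Unset Printing Implicit Defensive.

(** The argument rests on one operation: attaching a set [L] of new leaves to a
    vertex [v] of a tree.  It yields a tree again, raises the degree of [v] by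
    [#|L|], gives the new vertices degree 1 and raises the degree sum by
    [2 * #|L|].  Hence, when [l] divides [#|L|], a tree with all degrees
    congruent to 1 modulo [l] stays one.  Starting from an edge of [G] and
    attaching [l] leaves at a time, [congruent_spanning_subtree] reaches a
    spanning tree of [G] as soon as [l] divides [n - 2] and every vertex set [S]
    met on the way has a vertex with at least [l] neighbours outside [S].

    Part (2).  For [l = 1] connectedness provides such a vertex.  For [l >= 2]
    it comes from double counting ([dense_extension]).  If every vertex of [S]
    had at most [l - 1] neighbours outside [S], there would be at most
    [(l - 1) |S|] edges between [S] and its complement [R].  On the other hand
    each vertex of [R] sends at least [delta - |R| + 1] edges to [S].  With
    [n = 2 + k l] and [delta >= (l - 1) k + 2] these bounds are incompatible
    ([dense_extension_arith]).  So the greedy process never gets stuck.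

    Part (1).  Apply the same process with [l = 1] inside the tree [T] itself:
    it produces a spanning tree [H] of [T] with degree sum [2 (n - 1)], and
    [H = T] because an edge of [T] missing from [H] would close a cycle.  So the
    degree sum of a tree is [2 (n - 1)]; in particular it has a leaf, all degrees
    of an [l]-congruent tree are congruent to 1, and summing them gives
    [2 (n - 1) = n] modulo [l], that is [n = 2] modulo [l]. *)

Section Graphs.
Variable V : finType.
Implicit Types (G T : sgraph V) (S L : {set V}) (u v w x : V).

(** * Trees on a vertex subset, and attaching leaves *)

Lemma exists_edge_leaving G S :
  connected_graph G -> S != set0 -> S != [set: V] ->
  exists v x, [/\ v \in S, x \notin S & G v x].
Proof.
case=> _ conG /set0Pn[s sS] SnT.
have [/'exists_existsP[v [x /and3P[]]]|/existsPn none] :=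
  boolP [exists v, exists x, [&& v \in S, x \notin S & G v x]].
  by exists v, x.
have cl : closed G (mem S).
  apply: (intro_closed (sym_connect_sym (@adj_sym _ G))) => v x Gvx vS.
  by apply: contraR (none v) => xS; apply/existsP; exists x; apply/and3P.
by case/eqP: SnT; apply/setP=> x; rewrite inE -(closed_connect cl (conG s x)).
Qed.

Lemma exists_neighbour G v :
  connected_graph G -> 1 < #|V| -> exists x, G v x.
Proof.
move=> conG V2.
have [||u [x [/set1P-> _ Gvx]]] := exists_edge_leaving conG (S := [set v]).
- by apply/set0Pn; exists v; rewrite inE.
- by apply: contraTneq V2 => vT; rewrite -cardsT -vT cards1.
- by exists x.
Qed.

(** A tree on the vertices [S] is represented on the whole type [V], with the
    vertices outside [S] isolated, so that growing a tree changes only the edge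
    relation and [S]. *)
Definition subtree G T S : Prop :=
  [/\ subrel T G, forall u v, T u v -> u \in S,
      {in S &, forall u v, connect T u v} & acyclic_graph T].

Definition empty_graph : sgraph V :=
  @SGraph V (fun _ _ => false) (fun _ _ => erefl) (fun _ => erefl).

Lemma subtree_singleton G v : subtree G empty_graph [set v].
Proof. by split=> // [u w /set1P-> /set1P->|[|x [|y c]]]. Qed.

Section Attach.
Variables (T : sgraph V) (v : V) (L : {set V}).
Hypothesis vL : v \notin L.

Let attach_rel : rel V :=
  [rel a b | [|| T a b, (a == v) && (b \in L) | (b == v) && (a \in L)]].

Let attach_sym : symmetric attach_rel.
Proof.
by move=> a b; rewrite /attach_rel /= adj_sym; congr (_ || _); rewrite orbC.
Qed.

Let attach_irrefl : irreflexive attach_rel.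
Proof.
move=> a; rewrite /attach_rel /= adj_irrefl /= orbb.
by apply/andP=> -[/eqP->]; apply/negP.
Qed.

Definition attach : sgraph V := SGraph attach_sym attach_irrefl.

Lemma attachE a b :
  attach a b = [|| T a b, (a == v) && (b \in L) | (b == v) && (a \in L)].
Proof. by []. Qed.

Variables (G : sgraph V) (S : {set V}).
Hypotheses (subT : subtree G T S) (vS : v \in S) (LS : [disjoint L & S]).

Let offS x : x \in L -> x \notin S.
Proof. by move=> xL; rewrite (disjointFr LS). Qed.

Let noT x y : x \in L -> T x y = false.
Proof.
by case: subT => _ TS _ _ /offS; apply: contraNF; apply: TS.
Qed.

Lemma attach_leafE x y : x \in L -> attach x y = (y == v).
Proof.
move=> xL; rewrite attachE noT // xL andbT.
by case: eqP xL => // ->; rewrite (negbTE vL).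
Qed.

(** A cycle with at least three vertices that meets [L] would have [v] both just
    before and just after a leaf, hence twice; a cycle that avoids [L] is a cycle
    of [T]. *)
Lemma attach_acyclic : acyclic_graph attach.
Proof.
move=> c ucc.
have [/hasP[x xc xL]|/hasPn noL] := boolP (has (mem L) c); last first.
  case: subT => _ _ _; apply; case/andP: ucc => cc uc; rewrite /ucycle uc andbT.
  have /allP al : {subset c <= [predC L]} by move=> x /noL.
  apply: sub_in_cycle al cc => a b; rewrite !inE attachE => aL bL.
  by rewrite (negbTE aL) (negbTE bL) !andbF !orbF.
(* Rotate the cycle so that it starts at the leaf [x]. *)
case: (rot_to xc) => i c' rc.
rewrite -(size_rot i) rc; move: ucc; rewrite -(rot_ucycle i) rc.
case: c' {rc} => [|y [|z c']] //; rewrite /ucycle.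
rewrite (cycle_path x) => /andP[/and3P[lx xy _]].
have -> : y = v by apply/eqP; rewrite -(attach_leafE y xL).
have <- : last z c' = v.
  by apply/eqP; rewrite -(attach_leafE (last z c') xL) adj_sym.
by rewrite !cons_uniq mem_last andbF.
Qed.

Lemma subtree_attach :
  (forall x, x \in L -> G v x) -> subtree G attach (S :|: L).
Proof.
case: subT => sTG TS conT _ GL; split.
- move=> a b; rewrite attachE => /or3P[|/andP[/eqP-> /GL]|/andP[/eqP-> /GL]] //; first exact: sTG.
  by rewrite adj_sym.
- move=> a b; rewrite inE attachE => /or3P[/TS->|/andP[/eqP-> _]|/andP[_ ->]] //.
    by rewrite vS.
  by rewrite orbT.
- have tov : forall a, a \in S :|: L -> connect attach v a.
    move=> a /setUP[aS|aL].
      apply: connect_sub (conT v a vS aS) => x y Txy.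
      by apply: connect1; rewrite attachE Txy.
    by apply: connect1; rewrite adj_sym attach_leafE.
  move=> a b /tov va /tov; apply: connect_trans.
  by rewrite (sym_connect_sym (@adj_sym _ attach)).
- exact: attach_acyclic.
Qed.

Lemma degree_attach u :
  degree attach u = degree T u + (if u == v then #|L| else 0) + (u \in L).
Proof.
case: subT => sTG TS _ _; rewrite /degree.
have [->|uv] := eqVneq u v.
  rewrite (negbTE vL) addn0 -cardsUI.
  have -> : [set x | T v x] :&: L = set0.
    apply/setP=> x; rewrite !inE; apply/andP=> -[Tvx /noT].
    by rewrite adj_sym in Tvx; move/(_ v); rewrite Tvx.
  rewrite cards0 addn0; apply: eq_card => x; rewrite !inE attachE eqxx /=.
  by rewrite (negbTE vL) andbF orbF.
rewrite addn0; have [uL|uL] := boolP (u \in L).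
  rewrite [X in X + _]eq_card0 => [|x]; last by rewrite inE noT.
  rewrite -[RHS](cards1 v); apply: eq_card => x.
  by rewrite !inE attach_leafE.
rewrite addn0; apply: eq_card => x.
by rewrite !inE attachE (negbTE uv) (negbTE uL) andbF !orbF.
Qed.

Lemma sum_degree_attach :
  \sum_u degree attach u = \sum_u degree T u + #|L|.*2.
Proof.
under eq_bigr do rewrite degree_attach.
rewrite !big_split /= -addnA; congr (_ + _).
rewrite -big_mkcond big_pred1_eq -addnn; congr (_ + _).
by rewrite -sum1_card [RHS]big_mkcond; apply: eq_bigr => u _; case: (u \in L).
Qed.

End Attach.

(** * Growing a congruent spanning tree *)

(** The degree sum, twice the number of edges of a tree, is carried along so
    that the growth process also counts edges. *)
Definition congruent_subtree l G T S : Prop :=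
  [/\ subtree G T S, {in S, forall v, degree T v = 1 %[mod l]}
    & \sum_v degree T v + 2 = #|S|.*2].

Lemma congruent_subtree_edge l G u v :
  G u v -> exists T, congruent_subtree l G T [set u; v].
Proof.
move=> Guv.
have uv : u \notin [set v].
  by rewrite inE; apply: contraTneq Guv => ->; rewrite adj_irrefl.
have dis : [disjoint [set v] & [set u]].
  by rewrite disjoints1 inE eq_sym; rewrite inE in uv.
have sub0 := subtree_singleton G u.
have us : u \in [set u] by rewrite inE.
have d0 w : degree empty_graph w = 0.
  by apply: eq_card0 => x; rewrite inE.
exists (attach empty_graph uv); split.
- by apply: subtree_attach => // x /set1P->.
- move=> w ww; rewrite (degree_attach uv sub0 dis) d0 cards1.
  congr (_ %% l); move: ww; rewrite !inE; have [->|_] := eqVneq w u.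
    by move: uv; rewrite inE => /negbTE->.
  by move=> /= ->.
- rewrite (sum_degree_attach uv sub0 dis) big1 => [|w _]; last exact: d0.
  by rewrite cards1 cards2; move: uv; rewrite inE => ->.
Qed.

Lemma congruent_subtree_extend l G T S v L :
  congruent_subtree l G T S -> v \in S -> [disjoint L & S] -> l %| #|L| ->
  (forall x, x \in L -> G v x) ->
  exists T', congruent_subtree l G T' (S :|: L).
Proof.
move=> [subT degT sumT] vS LS lL GL.
have vL : v \notin L by rewrite (disjointFl LS).
exists (attach T vL); split.
- exact: subtree_attach.
- move=> u uSL; rewrite (degree_attach vL subT LS).
  have [uL|uL] := boolP (u \in L).
    have -> : u == v = false by apply: contraNF vL => /eqP<-.
    case: subT => _ TS _ _; rewrite /degree eq_card0 // => x; rewrite inE.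
    by apply: contraTF uL => /TS uS; rewrite (disjointFl LS).
  have uS : u \in S by move: uSL; rewrite inE (negbTE uL) orbF.
  rewrite addn0; case: (u == v); last by rewrite addn0; exact: degT.
  by rewrite -modnDmr (eqP lL) addn0; exact: degT.
- rewrite (sum_degree_attach vL subT LS).
  have := cardsUI S L; rewrite setIC (disjoint_setI0 LS) cards0; lia.
Qed.

(** Attaching [l] leaves preserves the divisibility of [#|~: S|] by [l], so the
    process ends exactly at [S = V]; in its last step [#|~: S| = l] and all the
    remaining vertices become leaves of the same [v]. *)
Lemma congruent_spanning_subtree l G :
  0 < l -> connected_graph G -> 1 < #|V| -> l %| #|V| - 2 ->
  (forall S, 1 < #|S| -> S != [set: V] -> l %| #|~: S| ->
     exists2 v, v \in S & l <= #|[set x in ~: S | G v x]|) ->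
  exists T, congruent_subtree l G T [set: V].
Proof.
move=> l0 conG V2 lV step.
suff grow : forall m S T, #|~: S| < m -> 1 < #|S| -> l %| #|~: S| ->
    congruent_subtree l G T S -> exists T', congruent_subtree l G T' [set: V].
  have [u _] : exists u, u \in V by apply/card_gt0P; case: conG.
  have [v Guv] := exists_neighbour u conG V2.
  have [T subT] := congruent_subtree_edge l Guv.
  have c2 : #|[set u; v]| = 2.
    by rewrite cards2; case: eqP Guv => // ->; rewrite adj_irrefl.
  apply: (grow _ [set u; v] T (ltnSn _)) => //; first by rewrite c2.
  by rewrite cardsCs setCK c2.
elim=> // m IHm S T; rewrite ltnS => Sm S2 lS subT.
have [ST|SnT] := eqVneq S [set: V]; first by exists T; rewrite -ST.
have [v vS] := step S S2 SnT lS.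
case/card_geqP=> s [us /eqP ss sN].
pose L := [set x in s].
have cL : #|L| = l by rewrite cardsE; rewrite (card_uniqP us) (eqP ss).
have Ls : L \subset ~: S.
  by apply/subsetP=> x; rewrite !inE => /sN; rewrite !inE => /andP[].
have LS : [disjoint L & S] by rewrite disjoints_subset.
have [|x|T' subT'] := congruent_subtree_extend subT vS LS.
- by rewrite cL.
- by rewrite !inE => /sN; rewrite !inE => /andP[].
have := cardsUI S L; rewrite setIC (disjoint_setI0 LS) cards0 addn0 cL => cU.
have := cardsC S; have := cardsC (S :|: L); rewrite cU => c1 c2.
have c3 : #|~: S| = #|~: (S :|: L)| + l by lia.
apply: IHm subT'; [lia | by rewrite cU; lia|].
by move: lS; rewrite c3 dvdn_addl.
Qed.

(** * Degree sum and leaves of a tree *)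

(** An edge of [T] outside [H] closes a cycle of [T] with the [H]-path joining
    its ends, which has at least two edges. *)
Lemma tree_spanning_subgraph_eq T H :
  acyclic_graph T -> subrel H T -> (forall u v, connect H u v) -> T =2 H.
Proof.
move=> acT sHT conH u v; apply/idP/idP => [Tuv|]; last exact: sHT.
have /connectP[p0 /shortenP[p pp up _] lp] := conH u v.
case: p pp up lp => [|x [|y p]] pp up lp.
- by rewrite lp adj_irrefl in Tuv.
- by rewrite lp; case/andP: pp.
have /acT // : ucycle T [:: u, x, y & p].
rewrite /ucycle up andbT (cycle_path u) -[last _ _]lp.
by apply/andP; split; [rewrite adj_sym | apply: sub_path sHT _ _ pp].
Qed.

(** With [l = 1] the growth process runs inside any connected graph; inside a
    tree it rebuilds that tree, and its edge count comes for free. *)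
Lemma sum_degree_tree T :
  is_tree T -> 1 < #|V| -> \sum_v degree T v + 2 = #|V|.*2.
Proof.
move=> [conT acT] V2.
have [||S S2 SnT _|H [[sHT _ conH _] _ sumH]] :=
  @congruent_spanning_subtree 1 T _ conT V2 => //.
- have [|v [x [vS xS Tvx]]] := exists_edge_leaving conT _ SnT.
    by rewrite -card_gt0; lia.
  by exists v => //; apply/card_gt0P; exists x; rewrite !inE xS.
- rewrite -cardsT -sumH; congr (_ + _); apply: eq_bigr => v _.
  apply: eq_card => x; rewrite !inE.
  by apply: tree_spanning_subgraph_eq => // a b; apply: conH; rewrite inE.
Qed.

Lemma tree_has_leaf T : is_tree T -> 1 < #|V| -> exists v, degree T v = 1.
Proof.
move=> treeT V2; have sumT := sum_degree_tree treeT V2.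
have [/existsP[v /eqP]|/existsPn noleaf] := boolP [exists v, degree T v == 1].
  by exists v.
have deg2 v : 1 < degree T v.
  suff : 0 < degree T v by have := noleaf v; lia.
  have [x Tvx] : exists x, T v x by apply: exists_neighbour => //; case: treeT.
  by apply/card_gt0P; exists x; rewrite inE.
have : #|V| * 2 <= \sum_v degree T v by rewrite -sum_nat_const leq_sum.
by lia.
Qed.

Lemma congruent_tree_order l T : congruent_tree l T -> #|V| = 2 %[mod l].
Proof.
case=> treeT V2 congT.
have [v0 dv0] := tree_has_leaf treeT V2.
have : \sum_v degree T v = #|V| %[mod l].
  rewrite -modn_summ -sum1_card -[RHS]modn_summ; congr (_ %% l).
  by apply: eq_bigr => v _; rewrite (congT v v0) dv0.
(* The degree sum [s] satisfies [s + 2 = 2 n] and [s = n] modulo [l]. *)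
move/eqP; rewrite -(eqn_modDr 2) (sum_degree_tree treeT V2) -addnn.
by rewrite eqn_modDl => /eqP.
Qed.

(** * Extending a tree in a dense graph *)

(** The inequality is strict because [v], which lies in [S], is not its own
    neighbour. *)
Lemma degree_lt_split G S v :
  v \in S -> degree G v < #|S| + #|[set x in ~: S | G v x]|.
Proof.
move=> vS; rewrite /degree -(cardsID S).
have -> : [set x | G v x] :\: S = [set x in ~: S | G v x].
  by apply/setP=> x; rewrite !inE.
rewrite ltn_add2r; apply: proper_card; apply/properP; split.
  exact: subsetIr.
by exists v => //; rewrite !inE adj_irrefl.
Qed.

Lemma double_count_adj G S (R : {set V}) :
  \sum_(v in S) #|[set x in R | G v x]| = \sum_(x in R) #|[set v in S | G x v]|.
Proof.
have E (A : {set V}) w : #|[set x in A | G w x]| = \sum_(x in A) G w x.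
  rewrite -sum1_card big_mkcond [RHS]big_mkcond; apply: eq_bigr => x _.
  by rewrite !inE; case: (x \in A); case: (G w x).
under eq_bigr do rewrite E; under [RHS]eq_bigr do rewrite E.
by rewrite exchange_big /=; do 2!apply: eq_bigr => ? _; rewrite adj_sym.
Qed.

(** With [s = #|S|] and [r = #|~: S|], the conclusion says that the lower bound
    [r (D + 1 - r)] on the number of edges leaving [S] exceeds the upper bound
    [s (l - 1)].  Write [r = (a + 1) l], [s = b l + 2] and [l = p + 2].  The
    density gives [D >= (l - 1) (a + 1 + b) + 2]; the bound [D + 1 < s + l], the
    degree bound at a vertex of [S], then forces [b >= a (l - 1) + 1].  With this
    [b], setting [b = a (l - 1) + 1 + c] turns the claim into an inequality
    between polynomials in [a], [c] and [p]. *)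
Lemma dense_extension_arith l n D s r :
  1 < l -> n = 2 %[mod l] -> l.-1 * n < l * D -> 1 < s -> 0 < r ->
  s + r = n -> l %| r -> D.+1 < s + l -> s * l.-1 < r * (D.+1 - r).
Proof.
move=> l1 nl dens s1 r0 srn /dvdnP[m rE] Dub.
have /dvdnP[k nE] : l %| n - 2 by rewrite -eqn_mod_dvd; [apply/eqP | lia].
have [a mE] : exists a, m = a.+1 by exists m.-1; case: m rE => [|m]; lia.
have ak : a.+1 <= k by rewrite -(@leq_pmul2r l) -?mE; lia.
have [b kE] : exists b, k = a.+1 + b by exists (k - a.+1); lia.
have [p lE] : exists p, l = p.+2 by exists l.-2; lia.
subst m k l r; have {nl ak nE}nE : n = (a.+1 + b) * p.+2 + 2 by lia.
have {srn}sE : s = b * p.+2 + 2 by lia.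
subst n s; rewrite [_.-1]/= in dens *.
have Dlb : p.+1 * (a.+1 + b) + 2 <= D.
  rewrite leqNgt; apply/negP=> Dlt; move: dens.
  have : p.+2 * D <= p.+2 * (p.+1 * (a.+1 + b) + 1) by rewrite leq_mul2l; lia.
  by lia.
have bE : a * p.+1 + 1 <= b by lia.
have [q qE] : exists q, D.+1 = a.+1 * p.+2 + q.
  by exists (D.+1 - a.+1 * p.+2); lia.
have qb : p.+1 * b + 2 <= q + a by lia.
have [c cE] : exists c, b = a * p.+1 + 1 + c by exists (b - (a * p.+1 + 1)); lia.
rewrite qE addKn; subst b.
have qlb : p * (a * p.+1 + 1 + c) + (a * p + 1 + c) + 2 <= q by lia.
apply: leq_trans (leq_mul (leqnn _) qlb).
nia.
Qed.

(** Double counting of the edges between [S] and its complement, under the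
    assumption that every vertex of [S] has fewer than [l] of them. *)
Lemma dense_extension l G S :
  1 < l -> #|V| = 2 %[mod l] -> l.-1 * #|V| < l * min_degree G ->
  1 < #|S| -> S != [set: V] -> l %| #|~: S| ->
  exists2 v, v \in S & l <= #|[set x in ~: S | G v x]|.
Proof.
move=> l1 nl dens S2 SnT lS.
have [/exists_inP //|/exists_inPn few] :=
  boolP [exists v in S, l <= #|[set x in ~: S | G v x]|].
have few' v : v \in S -> #|[set x in ~: S | G v x]| <= l.-1.
  by move=> /few; rewrite -ltnNge; lia.
have [v vS] : exists v, v \in S by apply/card_gt0P; lia.
have Dub : (min_degree G).+1 < #|S| + l.
  have := min_degree_le G v; have := degree_lt_split G vS.
  by have := few' v vS; lia.
have r0 : 0 < #|~: S|.
  rewrite card_gt0; apply: contra SnT => /eqP/(congr1 (@setC V)).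
  by rewrite setCK setC0 => ->.
have := dense_extension_arith l1 nl dens S2 r0 (cardsC S) lS Dub.
rewrite ltnNge => /negP[].
have lower : #|~: S| * ((min_degree G).+1 - #|~: S|) <=
    \sum_(x in ~: S) #|[set v in S | G x v]|.
  rewrite -sum_nat_const; apply: leq_sum => x xS.
  have := min_degree_le G x; have := degree_lt_split G xS.
  by rewrite setCK; lia.
apply: leq_trans lower _.
by rewrite -double_count_adj -sum_nat_const; apply: leq_sum.
Qed.

End Graphs.

Theorem theorem1p9 (l n : nat) (V : finType) (G : sgraph V)
    (hl : 0 < l) (hG : connected_graph G) (hn : #|V| = n) (hn2 : 2 <= n) :
  ((exists T : sgraph V, congruent_spanning_tree l G T) -> n = 2 %[mod l]) /\
  (n = 2 %[mod l] ->
   ((l%:R - 1) * n%:R / l%:R < (min_degree G)%:R :> rat)%R ->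
   exists T : sgraph V, congruent_spanning_tree l G T).
Proof.
subst n; split=> [[T [_ congT]]|nl dens]; first exact: congruent_tree_order congT.
have densN : l.-1 * #|V| < l * min_degree G.
  case: l hl dens {nl} => // l _.
  rewrite Num.Theory.ltr_pdivrMr ?Num.Theory.ltr0n //.
  have -> : (l.+1%:R - 1 = l%:R :> rat)%R by rewrite -GRing.natr1 GRing.addrK.
  by rewrite -!GRing.natrM Num.Theory.ltr_nat [X in _ < X]mulnC.
have l2 : l %| #|V| - 2 by rewrite -eqn_mod_dvd //; apply/eqP.
have [|T [[sTG _ conT acT] degT _]] := congruent_spanning_subtree hl hG hn2 l2.
  move=> S S2 SnT lS; have [l1|l1] := leqP l 1; last exact: dense_extension.
  have [|v [x [vS xS Gvx]]] := exists_edge_leaving hG _ SnT.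
    by rewrite -card_gt0; lia.
  exists v => //; apply: leq_trans l1 _; apply/card_gt0P.
  by exists x; rewrite !inE xS.
exists T; split=> //; split=> // [|u v]; last by rewrite !degT ?inE.
split=> //; split=> [|u v]; first exact: leq_trans hn2.
by apply: conT; rewrite inE.
Qed.
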